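(* Let $G=G(V,\omega,\gamma)$ be an oscillator group embedded in a standard oscillator group $G_A$, with Lie algebras $\mathfrak g\subset\mathfrak g_A$, and assume that $D(V)\subset V$ is dense. Then the non-empty proper open invariant cones in the oscillator algebra $\mathfrak g$ are exactly the cones $\pm W_d\cap\mathfrak g$, where $d\in\mathbb R\cup\{\infty\}$. In particular, every open invariant cone in $\mathfrak g$ is the intersection of an open invariant cone in $\mathfrak g_A$ with $\mathfrak g$.
   Context: Oscillator group: $(V,\omega)$ is a locally convex symplectic (real) vector space, $V\ne0$, $\gamma:\mathbb R\to\mathrm{Sp}(V,\omega)$ a one-parameter group defining a smooth action of $\mathbb R$ on $V$, $D=\gamma'(0)$. $G(V,\omega,\gamma)=\mathbb R\times V\times\mathbb R$ with $(t,x,s)(t',x',s')=(t+t'+\frac12\omega(x,\gamma(s)x'),x+\gamma(s)x',s+s')$; its Lie algebra is $\mathfrak g=\mathbb R\times V\times\mathbb R$ with $[(t,v,s),(t',v',s')]=(\omega(v,v'),sDv'-s'Dv,0)$. It is always assumed that for each $x\in V$ the curve $t\mapsto\gamma(t)x$ has a $V$-valued smooth antiderivative, so $G$ has an exponential map. Standard oscillator group: let $H_A\neq 0$ be a complex Hilbert space, $A\ge 0$ self-adjoint on $H_A$ with $\ker A=0$, $\gamma_A(t)=e^{itA}$, $V_A=C^\infty(A)=\bigcap_k\mathcal D(A^k)$ with the $C^\infty$-topology (seminorms $\|A^kx\|$), $\omega_A(x,y)=\mathrm{Im}\langle Ax,y\rangle$ (inner product linear in the first argument). $G_A=G(V_A,\omega_A,\gamma_A)$,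 with Lie algebra $\mathfrak g_A=\mathbb R\times V_A\times\mathbb R$ and $D=iA|_{V_A}$. Embedding (standing assumption): there is a continuous linear injection $V\hookrightarrow V_A$ with dense range, regarded as an inclusion, such that the corresponding inclusions $G\hookrightarrow G_A$ and $\mathfrak g\hookrightarrow\mathfrak g_A$ (identity on the $\mathbb R$-factors) are morphisms of Lie groups and Lie algebras; thus $\omega=\omega_A|_{V\times V}$, $\gamma(t)=\gamma_A(t)|_V$. The topology of $V$ may be finer than that induced from $V_A$. $\|\cdot\|$ is the norm of $H_A$. Cones are convex; a cone in a Lie algebra is invariant if it is invariant under the adjoint action of the Lie group, and proper if it is not the whole Lie algebra. $W_\infty=\mathbb R\times V_A\times\,]0,\infty[$ and, for $d\in\mathbb R$, $W_d=\{(t,x,s)\in W_\infty: t-\frac1{2s}\|x\|^2+ds>0\}$. *)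

(* Defs.v *)
From HB Require Import structures.
From mathcomp Require Import all_boot all_order all_algebra.
From mathcomp Require Import complex.
From mathcomp Require Import all_classical all_reals all_analysis.

Set Implicit Arguments.
Unset Strict Implicit.
Unset Printing Implicit Defensive.

Import Order.TTheory GRing.Theory Num.Theory.
Import numFieldNormedType.Exports.

Local Open Scope classical_set_scope.
Local Open Scope ring_scope.

Section calculus.
Variable R : realType.

Definition has_dirder (E F : tvsType R) (f : E -> F) (x v : E) (l : F) : Prop :=
  h^-1 *: (f (x + h *: v) - f x) @[h --> (0 : R)^'] --> l.

Definition dirder (E F : tvsType R) (f : E -> F) (x v : E) : F :=
  xget 0 [set l | has_dirder f x v l].

(* Bastiani's C^n maps: a C^n.+1 map is a continuous map all of whose
   directional derivatives exist and for which (x, v) |-> df(x)(v) is C^n on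
   E * E. *)
Fixpoint Ck (n : nat) (E F : tvsType R) (f : E -> F) : Prop :=
  match n with
  | 0 => continuous f
  | m.+1 => continuous f /\
      exists df : (E * E)%type -> F,
        (forall x v, has_dirder f x v (df (x, v))) /\ Ck m df
  end.

Definition smooth (E F : tvsType R) (f : E -> F) : Prop := forall n, Ck n f.

End calculus.

(* The underlying space both of G(V, omega, gamma) and of its Lie algebra. *)
Notation osc R V := (R^o * V * R^o)%type (only parsing).

Section oscillator.
Variables (R : realType) (V : tvsType R).

Record symplectic_form (omega : V -> V -> R) : Prop := SymplecticForm {
  symplectic_linearl : forall y, linear_for *%R (omega^~ y);
  symplectic_linearr : forall x, linear_for *%R (omega x);
  symplectic_alt : forall x, omega x x = 0;
  symplectic_nondeg : forall x, (forall y, omega x y = 0) -> x = 0;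
  symplectic_continuous : continuous (fun p : V * V => omega p.1 p.2)
}.

Record oscillator (omega : V -> V -> R) (gamma : R -> V -> V) : Prop :=
  Oscillator {
    osc_hausdorff : hausdorff_space V;
    osc_neq0 : exists x : V, x != 0;
    osc_symplectic : symplectic_form omega;
    osc_gamma_linear : forall t, linear (gamma t);
    osc_gamma_sp : forall t x y, omega (gamma t x) (gamma t y) = omega x y;
    osc_gamma0 : forall x, gamma 0 x = x;
    osc_gammaD : forall s t x, gamma (s + t) x = gamma s (gamma t x);
    osc_gamma_smooth : smooth (fun p : R^o * V => gamma p.1 p.2);
    osc_antiderivative : forall x, exists F : R^o -> V,
      smooth F /\ forall t, has_dirder F t 1 (gamma t x)
  }.

Variables (omega : V -> V -> R) (gamma : R -> V -> V).

Definition osc_D (x : V) : V := dirder (gamma^~ x : R^o -> V) 0 1.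

Definition osc_mul (g h : osc R V) : osc R V :=
  let: (t, x, s) := g in let: (t', x', s') := h in
  (t + t' + 2^-1 * omega x (gamma s x'), x + gamma s x', s + s').

Definition osc_inv (g : osc R V) : osc R V :=
  let: (t, x, s) := g in (- t, - gamma (- s) x, - s).

Definition osc_bracket (p q : osc R V) : osc R V :=
  let: (t, v, s) := p in let: (t', v', s') := q in
  (omega v v', s *: osc_D v' - s' *: osc_D v, 0).

(* The neutral element is 0, and Ad g is the derivative at 0 of the
   conjugation by g, computed in the global chart. *)
Definition osc_Ad (g y : osc R V) : osc R V :=
  dirder (fun p : osc R V => osc_mul (osc_mul g p) (osc_inv g)) 0 y.

Definition osc_invariant (C : set (osc R V)) : Prop :=
  forall g y, C y -> C (osc_Ad g y).

End oscillator.

(* Scaling by r > 0 only, so that cones need not contain 0. *)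
Definition convex_cone (R : realType) (E : lmodType R) (C : set E) : Prop :=
  convex_set (C : set (convex_lmodType E)) /\
  forall (r : R) x, 0 < r -> C x -> C (r *: x).

Definition open_invariant_cone (R : realType) (V : tvsType R)
    (omega : V -> V -> R) (gamma : R -> V -> V) (C : set (osc R V)) : Prop :=
  [/\ convex_cone C, open C & osc_invariant omega gamma C].

HB.mixin Record isHilbert (R : realType) H of CompleteNormedModule R[i] H := {
  hdot : {dot H for Num.conj};
  hdot_norm : forall x : H, `|x| ^+ 2 = hdot x x
}.

#[short(type="hilbertType")]
HB.structure Definition Hilbert (R : realType) :=
  {H of isHilbert R H & CompleteNormedModule R[i] H}.

Lemma real_complex_continuous (R : realType) :
  continuous (fun r : R => r%:C%C : R[i]^o).
Proof.
move=> r; apply/cvgrPdist_lt => e; rewrite ltcE /= => /andP[/eqP Ie Re].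
near=> s; rewrite -rmorphB normc_def /= expr0n addr0 sqrtr_sqr ltcE /= Ie eqxx.
by near: s; exact: (@cvgr_dist_lt _ _ _ _ _ _ _ cvg_id).
Unshelve. all: by end_near. Qed.

Lemma cvg_initialP (S : choiceType) (T : topologicalType) (f : S -> T)
    (F : set_system S) (x : S) : Filter F ->
  F --> (x : initial_topology f) <-> f y @[y --> F] --> f x.
Proof.
move=> FF; split=> [Fx|Fx U].
  by move=> B /(@initial_continuous S T f x) /Fx.
by case=> _ [[B oB <-] Bx] /filterS; apply; apply: Fx; exact: open_nbhs_nbhs.
Qed.

Section operators.
Variables (R : realType) (H : hilbertType R).

Definition hnorm (x : H) : R := complex.Re `|x|.

(* Possibly unbounded operators; the values outside of the domain are junk. *)
Record linop := Linop {
  dom : set H;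
  linop_fun :> H -> H;
  dom0 : dom 0;
  domP : forall (a : R[i]) x y, dom x -> dom y -> dom (a *: x + y);
  linopP : forall (a : R[i]) x y, dom x -> dom y ->
    linop_fun (a *: x + y) = a *: linop_fun x + linop_fun y
}.

Variable A : linop.

Definition self_adjoint : Prop :=
  dense (dom A) /\
  forall y z : H,
    (forall x, dom A x -> hdot (A x) y = hdot x z) <-> (dom A y /\ A y = z).

Definition nonnegative : Prop := forall x, dom A x -> 0 <= hdot (A x) x.

Definition trivial_kernel : Prop := forall x, dom A x -> A x = 0 -> x = 0.

Definition dom_exp (k : nat) : set H :=
  [set x | forall j, (j < k)%N -> dom A (iter j A x)].

(* e^{itA}: the strongly continuous one-parameter group of unitary operators
   whose infinitesimal generator is iA (as a relation, i.e. with its domain). *)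
Record expi := Expi {
  expi_fun :> R -> {linear H -> H};
  expi0 : forall x, expi_fun 0 x = x;
  expiD : forall s t x, expi_fun (s + t) x = expi_fun s (expi_fun t x);
  expi_unitary : forall t x y, hdot (expi_fun t x) (expi_fun t y) = hdot x y;
  expi_continuous : forall x, continuous (expi_fun^~ x : R -> H);
  expi_generator : forall x y,
    (dom A x /\ 'i%C *: A x = y) <->
    (h%:C%C^-1 *: (expi_fun h x - x) @[h --> (0 : R)^'] --> y)
}.

Definition cinf_pred : {pred H} :=
  [pred x | `[< (\bigcap_k dom_exp k) x >]].

Record Cinf := MkCinf { cinf_val :> H; cinf_valP : cinf_val \in cinf_pred }.

HB.instance Definition _ := [isSub for cinf_val].
HB.instance Definition _ := [Choice of Cinf by <:].


Lemma cinfP (x : H) :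
  reflect (forall k, dom A (iter k A x)) (x \in cinf_pred).
Proof.
apply: (iffP (asboolP _)) => [h k|h k _ j _]; last exact: h.
exact: (h k.+1 I k (ltnSn k)).
Qed.

Lemma cinf_dom (x : Cinf) k : dom A (iter k A x).
Proof. exact/cinfP/cinf_valP. Qed.

Lemma iter_linop (a : R[i]) (x y : H) k :
  x \in cinf_pred -> y \in cinf_pred ->
  iter k A (a *: x + y) = a *: iter k A x + iter k A y.
Proof.
move=> /cinfP dx /cinfP dy; elim: k => //= k ->.
exact: linopP.
Qed.

Lemma cinf_linear (a : R[i]) (x y : H) :
  x \in cinf_pred -> y \in cinf_pred -> a *: x + y \in cinf_pred.
Proof.
move=> dx dy; apply/cinfP => k; rewrite iter_linop//.
by apply: domP; apply/cinfP.
Qed.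

Lemma linop0 : A 0 = 0.
Proof.
have := linopP 1 (dom0 A) (dom0 A); rewrite !scale1r addr0.
by move=> /(congr1 (+%R (- A 0))); rewrite addNr addKr.
Qed.

Lemma iter_linop0 k : iter k A 0 = 0.
Proof. by elim: k => //= k ->; exact: linop0. Qed.

Lemma cinf0 : 0 \in cinf_pred.
Proof. by apply/cinfP => k; rewrite iter_linop0; exact: dom0. Qed.

Fact cinf_zmod_closed : zmod_closed cinf_pred.
Proof.
split=> [|x y dx dy]; first exact: cinf0.
by rewrite -scaleN1r addrC; exact: cinf_linear.
Qed.

HB.instance Definition _ := GRing.isZmodClosed.Build H cinf_pred
  cinf_zmod_closed.
HB.instance Definition _ := [SubChoice_isSubZmodule of Cinf by <:].

Lemma cinf_scalable (a : R[i]) (x : Cinf) : a *: (x : H) \in cinf_pred.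
Proof. by rewrite -[X in X \in _]addr0; apply: cinf_linear (cinf_valP x) cinf0. Qed.

(* C^oo(A) is a complex vector space; we only need the underlying real one. *)
Definition cinf_scale (r : R) (x : Cinf) : Cinf :=
  MkCinf (cinf_scalable r%:C%C x).

Fact cinf_scaleA (a b : R) x :
  cinf_scale a (cinf_scale b x) = cinf_scale (a * b) x.
Proof. by apply: val_inj; rewrite /= scalerA rmorphM. Qed.
Fact cinf_scale1 : left_id 1 cinf_scale.
Proof. by move=> x; apply: val_inj; rewrite /= scale1r. Qed.
Fact cinf_scaleDr : right_distributive cinf_scale +%R.
Proof. by move=> a x y; apply: val_inj; rewrite /= scalerDr. Qed.
Fact cinf_scaleDl x : {morph cinf_scale^~ x : a b / a + b}.
Proof. by move=> a b; apply: val_inj; rewrite /= rmorphD scalerDl. Qed.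

HB.instance Definition _ := GRing.Zmodule_isLmodule.Build R Cinf
  cinf_scaleA cinf_scale1 cinf_scaleDr cinf_scaleDl.

Lemma cinf_iterD k (u v : Cinf) :
  iter k A (cinf_val (u + v)) = iter k A u + iter k A v.
Proof.
by have := iter_linop 1 k (cinf_valP u) (cinf_valP v); rewrite !scale1r.
Qed.

Lemma cinf_iterZ k (b : R) (u : Cinf) :
  iter k A (cinf_val (b *: u)) = b%:C%C *: iter k A u.
Proof.
have := iter_linop b%:C%C k (cinf_valP u) cinf0; rewrite addr0 => ->.
by rewrite iter_linop0 addr0.
Qed.

(* The C^oo-topology is the coarsest one for which all the maps x |-> A^k x
   into H are continuous. *)
Definition jets (x : Cinf) : prod_topology (fun _ : nat => H) :=
  fun k => iter k A x.

HB.instance Definition _ := Uniform.copy Cinf (initial_topology jets).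

Lemma cvg_cinfP (F : set_system Cinf) (x : Cinf) : Filter F ->
  F --> x <-> forall k, iter k A (cinf_val y) @[y --> F] --> iter k A x.
Proof.
move=> FF.
apply: (iff_trans (cvg_initialP _ _ _)); apply: (iff_trans (cvg_sup _ _ _)).
by split=> h k; [have /cvg_initialP := h k | apply/cvg_initialP; exact: h].
Qed.

Lemma cinf_iter_continuous k : continuous (fun x : Cinf => iter k A x).
Proof. by move=> x; have /cvg_cinfP := @cvg_id _ (nbhs x); exact. Qed.

Fact cinf_add_continuous : continuous (fun p : Cinf * Cinf => p.1 + p.2).
Proof.
move=> [x y]; apply/cvg_cinfP => k.
change (iter k A (cinf_val (p.1 + p.2)) @[p --> (x, y)] -->
        iter k A (cinf_val (x + y))).
rewrite (funext (fun p : Cinf * Cinf => cinf_iterD k p.1 p.2)) cinf_iterD.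
apply: cvgD.
  by apply: (cvg_comp fst (fun z : Cinf => iter k A z));
    [exact: cvg_fst|exact: cinf_iter_continuous].
by apply: (cvg_comp snd (fun z : Cinf => iter k A z));
  [exact: cvg_snd|exact: cinf_iter_continuous].
Qed.

Fact cinf_scale_continuous : continuous (fun z : R^o * Cinf => z.1 *: z.2).
Proof.
move=> [a x]; apply/cvg_cinfP => k.
change (iter k A (cinf_val (z.1 *: z.2)) @[z --> (a, x)] -->
        iter k A (cinf_val (a *: x))).
rewrite (funext (fun z : R^o * Cinf => cinf_iterZ k z.1 z.2)) cinf_iterZ.
apply: cvgZ.
  by apply: (cvg_comp fst (fun r : R => r%:C%C : R[i]^o));
    [exact: cvg_fst|exact: real_complex_continuous].
by apply: (cvg_comp snd (fun z : Cinf => iter k A z));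
  [exact: cvg_snd|exact: cinf_iter_continuous].
Qed.

Let nball (x : Cinf) (n : nat) (e : R) : set Cinf :=
  [set y | forall k : 'I_n, `|iter k A y - iter k A x| < e%:C%C].

Let nball_nbhs (x : Cinf) (U : set Cinf) : nbhs x U ->
  exists n e, 0 < e /\ nball x n e `<=` U.
Proof.
pose F : set_system Cinf :=
  filter_from [set p : nat * R | 0 < p.2] (fun p => nball x p.1 p.2).
have FF : Filter F.
  apply: filter_from_filter; first by exists (0%N, 1) => /=.
  move=> [n e] [m d] /= e0 d0; exists (maxn n m, Num.min e d) => /=.
    by rewrite lt_min e0.
  move=> y hy; split=> k.
    have kn : (k < maxn n m)%N by rewrite leq_max ltn_ord.
    by apply: lt_le_trans (hy (Ordinal kn)) _; rewrite lecR ge_min lexx.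
  have kn : (k < maxn n m)%N by rewrite leq_max ltn_ord orbT.
  by apply: lt_le_trans (hy (Ordinal kn)) _; rewrite lecR ge_min lexx orbT.
suff Fx : F --> x by move=> /Fx [[n e] /= e0 sub]; exists n, e.
apply/cvg_cinfP => k; apply/cvgrPdist_lt => e.
rewrite ltcE /= => /andP[/eqP Ie Re].
exists (k.+1, complex.Re e) => //= y /(_ ord_max) /=.
by rewrite distrC; case: e Ie Re => a b /= ->.
Qed.

Let nball_open x n e : open (nball x n e).
Proof.
rewrite openE => y hy.
suff h (k : 'I_n) :
    \forall z \near y, `|iter k A (cinf_val z) - iter k A x| < e%:C%C.
  exact: filter_forall h.
have := @cinf_iter_continuous k y; move/cvgrPdist_lt.
move=> /(_ (e%:C%C - `|iter k A y - iter k A x|)).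
rewrite subr_gt0 => /(_ (hy k)); apply: filterS => z hz.
have -> : iter k A z - iter k A x =
    (iter k A z - iter k A y) + (iter k A y - iter k A x).
  by rewrite addrA subrK.
apply: le_lt_trans (ler_normD _ _) _.
by rewrite -ltrBrDr distrC.
Qed.

Let nball_convex x n e : convex_set (nball x n e : set (convex_lmodType Cinf)).
Proof.
apply/convex_setW => y z; rewrite !inE => hy hz l l0 l1; rewrite inE => k.
set a : R := l%:num.
have -> : conv l y z = a *: (y : Cinf) + (1 - a) *: (z : Cinf) by [].
rewrite cinf_iterD !cinf_iterZ.
have -> : a%:C%C *: iter k A y + (1 - a)%:C%C *: iter k A z - iter k A x =
    a%:C%C *: (iter k A y - iter k A x) +
    (1 - a)%:C%C *: (iter k A z - iter k A x).
  rewrite !scalerBr addrACA -opprD -scalerDl -rmorphD.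
  by rewrite (addrC a) subrK scale1r.
have a1 : 0 < 1 - a by rewrite subr_gt0.
have nC (b : R) (u : H) : 0 < b -> `|b%:C%C *: u| = b%:C%C * `|u|.
  by move=> b0; rewrite normrZ ger0_norm// lecR ltW.
apply: le_lt_trans (ler_normD _ _) _; rewrite !nC//.
have -> : e%:C%C = a%:C%C * e%:C%C + (1 - a)%:C%C * e%:C%C.
  by rewrite -mulrDl -rmorphD (addrC a) subrK mul1r.
by apply: ltrD; rewrite ltr_pM2l ?ltcR//.
Qed.

Fact cinf_locally_convex : exists2 B : set_system Cinf,
  (forall b, b \in B -> convex_set b) & basis B.
Proof.
exists [set B | exists x n e, B = nball x n e].
  by move=> B; rewrite inE => -[x [n [e ->]]]; exact: nball_convex.
split=> [B [x [n [e ->]]]|x B /nball_nbhs[n [e [e0 sub]]]].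
  exact: nball_open.
exists (nball x n e) => //; split; first by exists x, n, e.
by move=> k; rewrite subrr normr0 ltcR.
Qed.

HB.instance Definition _ := PreTopologicalNmodule_isTopologicalNmodule.Build
  Cinf cinf_add_continuous.
HB.instance Definition _ := TopologicalNmodule_isTopologicalLmodule.Build
  R Cinf cinf_scale_continuous.
HB.instance Definition _ := Uniform_isTvs.Build R Cinf cinf_locally_convex.

Variable U : expi.

Lemma expi_norm t (x : H) : `|U t x| = `|x|.
Proof.
by apply/eqP; rewrite -(@eqrXn2 _ 2)// !hdot_norm expi_unitary.
Qed.

Lemma expi_dom t (x : H) : dom A x -> dom A (U t x) /\ A (U t x) = U t (A x).
Proof.
move=> dx.
have lim_x := (expi_generator U x ('i%C *: A x)).1 (conj dx erefl).
suff /expi_generator[dUx AUx] :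
    h%:C%C^-1 *: (U h (U t x) - U t x) @[h --> (0 : R)^'] -->
    U t ('i%C *: A x).
  split=> //; move: AUx; rewrite linearZ /= => /(congr1 ( *:%R (- 'i%C))).
  by rewrite !scalerA mulNr -expr2 sqr_i opprK !scale1r.
apply/cvgrPdist_lt => e e0.
move: lim_x.
move=> /cvgrPdist_lt/(_ e e0).
apply: filterS => h; rewrite -(expi_norm t) linearB !linearZ/= linearB/=.
by have -> : U t (U h x) = U h (U t x) by rewrite -!expiD addrC.
Qed.

Lemma expi_cinf t (x : Cinf) : U t (cinf_val x) \in cinf_pred.
Proof.
suff h k : iter k A (U t (cinf_val x)) = U t (iter k A x).
  by apply/cinfP => k; rewrite h; apply: (expi_dom _ _).1; exact: cinf_dom.
by elim: k => //= k ->; apply: (expi_dom _ _).2; exact: cinf_dom.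
Qed.

Definition gammaA (t : R) (x : Cinf) : Cinf := MkCinf (expi_cinf t x).

Definition omegaA (x y : Cinf) : R :=
  complex.Im (hdot (A x) (cinf_val y)).

Definition W_infty : set (osc R Cinf) := [set p | 0 < p.2].

Definition W_fin (d : R) : set (osc R Cinf) :=
  [set p | W_infty p /\
    let: (t, x, s) := p in 0 < t - (2 * s)^-1 * hnorm (cinf_val x) ^+ 2 + d * s].

(* W_d for d in R \cup {oo}, where None stands for oo. *)
Definition W (d : option R) : set (osc R Cinf) :=
  if d is Some r then W_fin r else W_infty.

End operators.

Arguments omegaA {R H} A x y.
Arguments gammaA {R H A} U t x.
Arguments W_infty {R H} A.
Arguments W_fin {R H} A d.
Arguments W {R H} A d.

Section morphisms.
Variables (R : realType) (V V' : tvsType R).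
Variables (omega : V -> V -> R) (gamma : R -> V -> V).
Variables (omega' : V' -> V' -> R) (gamma' : R -> V' -> V').

Definition osc_group_morphism (f : osc R V -> osc R V') : Prop :=
  smooth f /\
  forall g h, f (osc_mul omega gamma g h) = osc_mul omega' gamma' (f g) (f h).

Definition osc_lie_morphism (f : osc R V -> osc R V') : Prop :=
  [/\ linear f, continuous f &
    forall p q, f (osc_bracket omega gamma p q) =
      osc_bracket omega' gamma' (f p) (f q)].

Definition osc_map (j : V -> V') (p : osc R V) : osc R V' :=
  let: (t, x, s) := p in (t, j x, s).

Record osc_embedding (j : {linear V -> V'}) : Prop := OscEmbedding {
  embedding_inj : injective j;
  embedding_continuous : continuous j;
  embedding_dense : dense (range j);
  embedding_group : osc_group_morphism (osc_map j);
  embedding_lie : osc_lie_morphism (osc_map j)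
}.

End morphisms.

(* Main.v *)
(* The function 2ts - |x|^2 is invariant under the adjoint action, and the
   perspective (x, s) |-> |x|^2 / s is convex, so the W_d are open invariant
   convex cones. Conversely let C be an open invariant convex cone. If C
   contains a point (t, x, 0), then x may be taken nonzero, and conjugation by V
   together with the nondegeneracy of omega puts the whole line R * {x} * {0}
   into C; hence C is stable under translations along the centre, and
   conjugation by V moves the points (t, 0, s) over a dense set, so C is
   everything. Otherwise C lies, up to sign, in s > 0. Conjugation by V then
   identifies (t, D y, s) in C with (t - |D y|^2/(2s), 0, s) in C, so on the
   dense set of points with x in D(V) the cone C is determined by the set
   I = {t | (t, 0, 1) in C}; I is an up-set by convexity applied to D y and
   - D y, hence C agrees with some W_d on that dense set. Two open convex sets
   that agree on a dense subset of the whole space are equal. *)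
Require Import Defs.
From HB Require Import structures.
From mathcomp Require Import all_boot all_order all_algebra.
From mathcomp Require Import complex.
From mathcomp Require Import all_classical all_reals all_analysis.
From mathcomp Require Import ring lra.

Set Implicit Arguments.
Unset Strict Implicit.
Unset Printing Implicit Defensive.

Import Order.TTheory GRing.Theory Num.Theory.
Import numFieldNormedType.Exports.

Local Open Scope classical_set_scope.
Local Open Scope ring_scope.

(** * Convex cones *)

Section convex_cones.
Variable R : realType.

(** Doubling a midpoint gives a sum; the additive form is the one used from here on. *)
Lemma convex_coneP (E : lmodType R) (C : set E) :
  convex_cone C <->
  (forall x y, C x -> C y -> C (x + y)) /\
  (forall (r : R) x, 0 < r -> C x -> C (r *: x)).
Proof.
split=> -[cC sC]; split=> //.
  move=> x y Cx Cy.
  have h0 : 0 <= 2^-1 :> R by rewrite invr_ge0.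
  have h1 : 2^-1 <= 1 :> R by rewrite invf_le1 ?ler1n.
  have := cC x y (Itv01 h0 h1).
  rewrite !inE => /(_ Cx Cy) /(sC 2 _ (ltr0Sn _ _)).
  have -> : @conv R (convex_lmodType E) (Itv01 h0 h1) x y =
    2^-1 *: x + (1 - 2^-1) *: y by [].
  have -> : 1 - 2^-1 = 2^-1 :> R by lra.
  by rewrite scalerDr !scalerA mulfV ?pnatr_eq0// !scale1r.
apply/convex_setW => x y; rewrite !inE => Cx Cy l l0 l1; rewrite inE.
have -> : conv l x y = l%:num *: (x : E) + (1 - l%:num) *: (y : E) by [].
by apply: cC; apply: sC; rewrite // subr_gt0.
Qed.

Lemma convex_coneN (E : lmodType R) (C : set E) :
  convex_cone C -> convex_cone (-%R @^-1` C).
Proof.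
move=> /convex_coneP[aC sC]; apply/convex_coneP; split=> [x y|r x] /=.
  by rewrite opprD; exact: aC.
by rewrite -scalerN; exact: sC.
Qed.

Section tvs_limits.
Context (E : tvsType R) {T : Type} {F : set_system T} {FF : Filter F}.

Lemma tvs_cvgD (f g : T -> E) (a b : E) :
  f @ F --> a -> g @ F --> b -> (f x + g x) @[x --> F] --> a + b.
Proof.
exact: (@continuous2_cvg T E E E F FF _ _ +%R a b (@add_continuous E (a, b))).
Qed.

Lemma tvs_cvgB (f g : T -> E) (a b : E) :
  f @ F --> a -> g @ F --> b -> (f x - g x) @[x --> F] --> a - b.
Proof.
exact: (@continuous2_cvg T E E E F FF _ _ (fun x y => x - y) a b
  (@sub_continuous E (a, b))).
Qed.

Lemma tvs_cvgZ (c : T -> R^o) (f : T -> E) (r : R^o) (a : E) :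
  c @ F --> r -> f @ F --> a -> (c x *: f x) @[x --> F] --> r *: a.
Proof.
exact: (@continuous2_cvg T R^o E E F FF _ _ (fun r x => r *: x) r a
  (@scale_continuous R E (r, a))).
Qed.

End tvs_limits.

(** Continuity of [h |-> x + h *: v] at 0. It serves to perturb a point of an open cone in one
    chosen direction. *)
Lemma open_line (E : tvsType R) (C : set E) (x v : E) : open C -> C x ->
  exists2 e : R, 0 < e & forall h, `|h| < e -> C (x + h *: v).
Proof.
move=> oC Cx.
have : (x + (h : R^o) *: v) @[h --> (0 : R^o)] --> x + 0 *: v.
  apply: tvs_cvgD; first exact: cvg_cst.
  by apply: tvs_cvgZ; [exact: cvg_id|exact: cvg_cst].
rewrite scale0r addr0.
move=> /(_ C (open_nbhs_nbhs (conj oC Cx))) /nbhs_ballP[e /= e0 sub].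
exists e => // h he; apply: sub => /=.
by rewrite /ball /= sub0r normrN.
Qed.

(* Every v of C1 is the midpoint of two points of C2, since C2 is dense near v
   and hence meets its own reflection through v. *)
Lemma cone_sub_dense (E : tvsType R) (C1 C2 S : set E) :
  open C1 -> open C2 -> convex_cone C2 -> dense S ->
  (forall x, S x -> C1 x -> C2 x) -> C1 `<=` C2.
Proof.
move=> oC1 oC2 /convex_coneP[aC2 sC2] dS sub v C1v.
pose refl (x : E) : E := 2 *: v - x.
have refl_cont : continuous refl.
  by move=> x; apply: tvs_cvgB; [exact: cvg_cst|exact: cvg_id].
have reflK : involutive refl by move=> x; rewrite /refl opprB addrC subrK.
have reflv : refl v = v by rewrite /refl scaler_nat mulr2n addrK.
have oP (B : set E) : open B -> open (refl @^-1` B).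
  by move=> oB; apply: open_comp => // x _; exact: refl_cont.
have [|x [[C1x C1rx] Sx]] := dS (C1 `&` refl @^-1` C1) _ (openI oC1 (oP _ oC1)).
  by exists v; split=> //=; rewrite reflv.
have C2x := sub _ Sx C1x.
(* [refl x] lies in [C1] and its reflection [x] in [C2], so density gives a point [y] of [S] in [C1]
   with [refl y] in [C2]. *)
have [|y [[C1y C2ry] Sy]] := dS (C1 `&` refl @^-1` C2) _ (openI oC1 (oP _ oC2)).
  by exists (refl x); split=> //=; rewrite reflK.
have -> : v = 2^-1 *: (y + refl y).
  by rewrite /refl addrC subrK scalerA mulVf ?pnatr_eq0// scale1r.
by apply: (sC2); [rewrite invr_gt0|apply: aC2 => //; exact: sub].
Qed.

End convex_cones.

(** * Limits and directional derivatives *)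

Section limits.
Variable R : realType.

Lemma hausdorff_pair (T U : topologicalType) :
  hausdorff_space T -> hausdorff_space U -> hausdorff_space (T * U)%type.
Proof.
move=> hT hU [a b] [c d] cl; congr pair.
  apply: hT => A B Aa Bc.
  have [] := cl (fst @^-1` A) (fst @^-1` B); [exact: cvg_fst|exact: cvg_fst|].
  by move=> [x y] [/= Ax Bx]; exists x.
apply: hU => A B Ab Bd.
have [] := cl (snd @^-1` A) (snd @^-1` B); [exact: cvg_snd|exact: cvg_snd|].
by move=> [x y] [/= Ay By]; exists y.
Qed.

Lemma cvg_osc (V : tvsType R) {T : Type} {F : set_system T} {FF : Filter F}
    (t s : T -> R) (x : T -> V) (t0 s0 : R) (x0 : V) :
  t @ F --> t0 -> x @ F --> x0 -> s @ F --> s0 ->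
  ((t y, x y, s y) : osc R V) @[y --> F] --> ((t0, x0, s0) : osc R V).
Proof.
move=> tF xF sF; apply: (@cvg_pair _ _ _ _ (nbhs ((t0, x0) : R^o * V))
  (nbhs (s0 : R^o))) => //.
exact: (@cvg_pair _ _ _ _ (nbhs (t0 : R^o)) (nbhs x0)).
Qed.

(** Limits in a Hausdorff space are unique, so [xget] can only return [l]. *)
Lemma dirderE (E F : tvsType R) (f : E -> F) (x v : E) (l : F) :
  hausdorff_space F -> has_dirder f x v l -> dirder f x v = l.
Proof.
move=> hF fl; rewrite /dirder; case: xgetP => [y _ /= fy|/(_ l)//].
exact: (cvg_unique hF fy fl).
Qed.

Lemma cvg_dnbhs0Mr (s : R) : s != 0 -> h * s @[h --> (0 : R)^'] --> (0 : R)^'.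
Proof.
move=> s0 A /=; rewrite /dnbhs /within /= => -[e /= e0 sub].
exists (e / `|s|) => /=; first by rewrite divr_gt0// normr_gt0.
move=> h /=; rewrite sub0r normrN => he h0; apply: sub => /=.
  by rewrite sub0r normrN normrM -ltr_pdivlMr// normr_gt0.
by rewrite mulf_neq0.
Qed.

End limits.

Lemma linear_for_mulZ (R : pzRingType) (V : lmodType R) (f : V -> R) a x :
  linear_for *%R f -> f (a *: x) = a * f x.
Proof.
move=> fl; have f0 : f 0 = 0.
  by apply: (addIr (f 0)); have := fl 1 0 0; rewrite scale1r mul1r addr0 add0r.
by have := fl a x 0; rewrite !addr0 f0 addr0.
Qed.

Lemma alternating_skew (R : realType) (V : lmodType R) (w : V -> V -> R) x y :
  (forall y, linear_for *%R (w^~ y)) -> (forall x, linear_for *%R (w x)) ->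
  (forall x, w x x = 0) -> w x y = - w y x.
Proof.
move=> wl wr walt; have := walt (x + y).
have := wl (x + y) 1 x y; rewrite scale1r mul1r => ->.
have := wr x 1 x y; rewrite scale1r mul1r => ->.
have := wr y 1 x y; rewrite scale1r mul1r => ->.
by rewrite !walt add0r addr0 => /eqP; rewrite addr_eq0 => /eqP.
Qed.

(** * The adjoint action *)

Section adjoint_action.
Variables (R : realType) (V : tvsType R).
Variables (omega : V -> V -> R) (gamma : R -> V -> V) (D : V -> V).
Hypothesis V_hausdorff : hausdorff_space V.
Hypothesis omegal : forall y, linear_for *%R (omega^~ y).
Hypothesis omegar : forall x, linear_for *%R (omega x).
Hypothesis omega_alt : forall x, omega x x = 0.
Hypothesis omega_cont : continuous (fun p : V * V => omega p.1 p.2).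
Hypothesis gamma_lin : forall t, linear (gamma t).
Hypothesis gamma0 : forall x, gamma 0 x = x.
Hypothesis gammaD : forall s t x, gamma (s + t) x = gamma s (gamma t x).
Hypothesis gamma_der :
  forall x, has_dirder (gamma^~ x : R^o -> V) 0 1 (D x).

Let omegaDl x y z : omega (x + y) z = omega x z + omega y z.
Proof. by have := omegal z 1 x y; rewrite scale1r mul1r. Qed.
Let omegaDr x y z : omega z (x + y) = omega z x + omega z y.
Proof. by have := omegar z 1 x y; rewrite scale1r mul1r. Qed.
Let omega0l z : omega 0 z = 0.
Proof. by apply: (addIr (omega 0 z)); rewrite -omegaDl !add0r. Qed.
Let omega0r z : omega z 0 = 0.
Proof. by apply: (addIr (omega z 0)); rewrite -omegaDr !add0r. Qed.
Let omegaZl a x z : omega (a *: x) z = a * omega x z.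
Proof. exact: (linear_for_mulZ a x (omegal z)). Qed.
Let omegaZr a x z : omega z (a *: x) = a * omega z x.
Proof. exact: linear_for_mulZ. Qed.
Let omegaNr x z : omega z (- x) = - omega z x.
Proof. by rewrite -scaleN1r omegaZr mulN1r. Qed.
Let omegaBr x y z : omega z (x - y) = omega z x - omega z y.
Proof. by rewrite omegaDr omegaNr. Qed.

Let omegaC x y : omega x y = - omega y x.
Proof. exact: alternating_skew. Qed.

Let gamma_cst0 t : gamma t 0 = 0.
Proof.
have := gamma_lin t 1 0 0; rewrite !scale1r !addr0 => /eqP.
by rewrite -subr_eq0 opprD addrA subrr sub0r oppr_eq0 => /eqP.
Qed.

Let gammaZ t a x : gamma t (a *: x) = a *: gamma t x.
Proof. by have := gamma_lin t a x 0; rewrite gamma_cst0 !addr0. Qed.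

Let gammaN t x : gamma t (- x) = - gamma t x.
Proof. by rewrite -scaleN1r gammaZ scaleN1r. Qed.

Lemma osc_conjE t x s t' x' s' :
  osc_mul omega gamma (osc_mul omega gamma (t, x, s) (t', x', s'))
    (osc_inv gamma (t, x, s)) =
  (t' + 2^-1 * omega x (gamma s x') - 2^-1 * omega x (gamma s' x)
     - 2^-1 * omega (gamma s x') (gamma s' x),
   x + gamma s x' - gamma s' x, s') :> osc R V.
Proof.
rewrite /osc_mul /osc_inv !gammaN -gammaD.
have -> : s + s' - s = s' by rewrite addrC addKr.
by rewrite omegaNr omegaDl; congr (_, _, _); ring.
Qed.

Let gamma_quotient x s :
  h^-1 *: (gamma (h * s) x - x) @[h --> (0 : R)^'] --> s *: D x.
Proof.
(* For [s = 0] the substitution [h * s] leaves the punctured neighbourhood of 0, but the quotient is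
   constantly 0. *)
have [->|s0] := eqVneq s 0.
  rewrite scale0r; apply: cvg_near_cst; near=> h.
  by rewrite mulr0 gamma0 subrr scaler0.
have gx : k^-1 *: (gamma k x - x) @[k --> (0 : R)^'] --> D x.
  have := @gamma_der x; rewrite /has_dirder gamma0.
  by under eq_fun do rewrite add0r /GRing.scale/= mulr1.
have gxs := cvg_comp _ _ (cvg_dnbhs0Mr s0) gx.
apply: cvg_trans (tvs_cvgZ (cvg_cst (s : R^o)) gxs).
apply: near_eq_cvg; near=> h.
by rewrite /= invfM scalerA mulrCA mulfV// mulr1.
Unshelve. all: by end_near. Qed.

Let gamma_cvg x s : gamma (h * s) x @[h --> (0 : R)^'] --> x.
Proof.
(* Differentiability gives continuity: [gamma (h * s) x] is [x] plus [h] times the convergent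
   quotient. *)
rewrite -[X in _ --> X]addr0 -(scale0r (s *: D x)).
apply: cvg_trans (tvs_cvgD (cvg_cst x)
  (tvs_cvgZ (@nbhs_dnbhs _ (0 : R^o)) (@gamma_quotient x s))).
apply: near_eq_cvg; near=> h.
have h0 : h != 0 by near: h; exact: nbhs_dnbhs_neq.
by rewrite /= scalerA mulfV// scale1r addrCA subrr addr0.
Unshelve. all: by end_near. Qed.

Lemma osc_DE x : osc_D gamma x = D x.
Proof. exact: dirderE (@gamma_der x). Qed.

(** Differentiating [osc_conjE] along [h *: (t', x', s')] produces two mixed terms in [x] and
    [gamma s x'], which skew-symmetry adds up to a full [omega x (gamma s x')]. As [D] is any
    pointwise derivative of [gamma], the formula serves both for V and for C^oo(A). *)
Lemma osc_AdE t x s t' x' s' :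
  osc_Ad omega gamma (t, x, s) (t', x', s') =
  (t' + omega x (gamma s x') - 2^-1 * s' * omega x (D x),
   gamma s x' - s' *: D x, s') :> osc R V.
Proof.
apply: dirderE.
  by do 2![apply: hausdorff_pair => //]; exact: norm_hausdorff.
rewrite /has_dirder.
have omega_lim (f g : R -> V) a b : f h @[h --> (0 : R)^'] --> a ->
    g h @[h --> (0 : R)^'] --> b ->
    omega (f h) (g h) @[h --> (0 : R)^'] --> omega a b.
  by apply: continuous2_cvg; exact: (@omega_cont (a, b)).
(* The difference quotient in coordinates: since [omega x x = 0], the term
   [omega x (gamma (h * s') x)] may be read as [omega x] of a difference. *)
apply: (@cvg_trans _ ((fun h : R => (t' + 2^-1 * omega x (gamma s x')
     - 2^-1 * omega x (h^-1 *: (gamma (h * s') x - x))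
     - 2^-1 * omega (gamma s x') (gamma (h * s') x),
   gamma s x' - h^-1 *: (gamma (h * s') x - x), s') : osc R V)
   @ (0 : R)^')); last first.
  apply: cvg_osc; last exact: cvg_cst; last first.
    by apply: tvs_cvgB; [exact: cvg_cst|exact: gamma_quotient].
  have -> : t' + omega x (gamma s x') - 2^-1 * s' * omega x (D x) =
    t' + 2^-1 * omega x (gamma s x') - 2^-1 * omega x (s' *: D x)
     - 2^-1 * omega (gamma s x') x.
    by rewrite omegaZr (omegaC (gamma s x') x); field.
  apply: cvgB; last first.
    by apply: cvgMr; apply: omega_lim; [exact: cvg_cst|exact: gamma_cvg].
  apply: cvgB; first exact: cvg_cst.
  by apply: cvgMr; apply: omega_lim; [exact: cvg_cst|exact: gamma_quotient].
apply: near_eq_cvg; near=> h.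
have h0 : h != 0 by near: h; exact: nbhs_dnbhs_neq.
rewrite add0r.
have -> : h *: (t', x', s') = (h * t', h *: x', h * s') :> osc R V by [].
have -> : (0 : osc R V) = (0, 0, 0) by [].
rewrite !osc_conjE gamma_cst0 gamma0 !gammaZ !omega0l !omega0r omega_alt.
have scP (a b c : R) (u v : V) : h^-1 *: ((a, u, c) - (b, v, 0) : osc R V) =
  (h^-1 * (a - b), h^-1 *: (u - v), h^-1 * (c - 0)) by [].
rewrite scP !omegaZr !omegaZl omegaBr omega_alt; congr (_, _, _).
- by rewrite !mulr0 !subr0 addr0; field.
- rewrite addr0 subrr subr0 (addrC x) -addrA -(opprB _ x).
  by rewrite [RHS]scalerBr scalerA mulVf// scale1r.
- by rewrite subr0 mulKf.
Unshelve. all: by end_near. Qed.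

(** This lets cones in [s < 0] be reflected into [s > 0]. *)
Lemma osc_AdN g : {morph osc_Ad omega gamma g : y / - y}.
Proof.
move: g => [[t x] s] [[t' x'] s'].
have oppE (a b : R) (u : V) : - ((a, u, b) : osc R V) = (- a, - u, - b) by [].
rewrite oppE !osc_AdE oppE gammaN omegaNr scaleNr opprK.
congr (_, _, _); last by rewrite opprB addrC.
by rewrite mulrN mulNr opprK opprB opprD addrC.
Qed.

End adjoint_action.

(** * The standard oscillator group *)

Section hilbert.
Variables (R : realType) (H : hilbertType R).
Implicit Types x y z : H.

(** The norm is [R[i]]-valued; nonnegativity there includes a vanishing imaginary part. *)
Lemma hnormE x : `|x| = (hnorm x)%:C%C.
Proof.
rewrite /hnorm; have := normr_ge0 x; rewrite lecE => /andP[/eqP].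
by case: `|x| => a b /= ->.
Qed.

Lemma hnorm_ge0 x : 0 <= hnorm x.
Proof. by rewrite -lecR -hnormE; exact: normr_ge0. Qed.

Lemma hnorm_eq0 x : hnorm x = 0 -> x = 0.
Proof. by move=> x0; apply/eqP; rewrite -normr_eq0 hnormE x0. Qed.

Lemma hnorm0 : hnorm (0 : H) = 0.
Proof. by rewrite /hnorm normr0. Qed.

Lemma hnormD_le x y : hnorm (x + y) <= hnorm x + hnorm y.
Proof. by rewrite -lecR rmorphD/= -!hnormE ler_normD. Qed.

Lemma hnormZ (a : R[i]) x : hnorm (a *: x) = complex.Re `|a| * hnorm x.
Proof.
rewrite {1}/hnorm normrZ hnormE.
by case: `|a| => u v /=; rewrite mulr0 subr0.
Qed.

Lemma hnormZr (a : R) x : hnorm (a%:C%C *: x) = `|a| * hnorm x.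
Proof. by rewrite hnormZ normc_def /= expr0n addr0 sqrtr_sqr. Qed.

Lemma hnormZi x : hnorm ('i%C *: x) = hnorm x.
Proof. by rewrite hnormZ normc_def /= expr0n add0r expr1n sqrtr1 mul1r. Qed.

Lemma hdot_conj x y : hdot x y = (hdot y x)^*.
Proof.
by rewrite (hermC (hdot : {hermitian H for false & Num.conj})) mul1r.
Qed.

Lemma Re_hdotC x y : complex.Re (hdot x y) = complex.Re (hdot y x).
Proof. by rewrite hdot_conj; case: (hdot y x). Qed.

Lemma Im_hdotC x y : complex.Im (hdot x y) = - complex.Im (hdot y x).
Proof. by rewrite hdot_conj; case: (hdot y x). Qed.

Lemma hnorm_sq x : hnorm x ^+ 2 = complex.Re (hdot x x).
Proof.
by rewrite -hdot_norm hnormE -rmorphXn.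
Qed.

Lemma hnormD_sq x y :
  hnorm (x + y) ^+ 2 = hnorm x ^+ 2 + hnorm y ^+ 2 + 2 * complex.Re (hdot x y).
Proof.
rewrite !hnorm_sq linearDl/= !linearDr/= !raddfD/= (Re_hdotC y x); ring.
Qed.

(** The second argument is conjugate linear, so ['i] comes out as [- 'i]. This expresses the
    symplectic form by real parts, hence by norms. *)
Lemma Re_hdotZi x y : complex.Re (hdot x ('i%C *: y)) = complex.Im (hdot x y).
Proof.
rewrite linearZr_LR/=; case: (hdot x y) => a b; rewrite /= ; ring.
Qed.

Lemma Re_hdotZr (a : R) x y :
  complex.Re (hdot x (a%:C%C *: y)) = a * complex.Re (hdot x y).
Proof.
rewrite linearZr_LR/=; case: (hdot x y) => u v; rewrite /= ; ring.
Qed.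

Lemma hnorm_continuous : continuous (@hnorm R H).
Proof.
move=> x; apply/cvgrPdist_lt => e e0.
have e0' : 0 < e%:C%C :> R[i] by rewrite ltcR.
near=> y.
have hxy : hnorm (x - y) < e.
  rewrite -ltcR -hnormE; near: y.
  exact: (@cvgr_dist_lt _ _ _ _ _ _ _ (@cvg_id _ (nbhs x))).
have h1 := hnormD_le (x - y) y; rewrite subrK in h1.
have h2 := hnormD_le (y - x) x; rewrite subrK in h2.
have h3 : hnorm (y - x) = hnorm (x - y) by rewrite /hnorm distrC.
rewrite ltr_norml; apply/andP; split; lra.
Unshelve. all: by end_near. Qed.

End hilbert.

(** * Smooth vectors of A, the adjoint action on them, and the cones W_d *)

Section smooth_vectors.
Variables (R : realType) (H : hilbertType R) (A : linop H).
Hypothesis A_ge0 : nonnegative A.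
Variable U : expi A.
Implicit Types x y z : Cinf A.

Lemma cinf_A_in x : A x \in cinf_pred A.
Proof. by apply/cinfP => k; rewrite -iterSr; exact: cinf_dom. Qed.

Definition cinf_D x : Cinf A :=
  MkCinf (cinf_scalable 'i%C (MkCinf (cinf_A_in x))).

Lemma cinf_D_val x : cinf_val (cinf_D x) = 'i%C *: A x.
Proof. by []. Qed.

Lemma cinf_val_continuous : continuous (@cinf_val R H A).
Proof. exact: (@cinf_iter_continuous _ _ A 0). Qed.

(** The inclusion into H is a continuous injection, so the seminorm of order 0 already separates
    points. *)
Lemma cinf_hausdorff : hausdorff_space (Cinf A).
Proof.
move=> x y cl; apply: val_inj; apply: norm_hausdorff => B C Bx Cy.
have [] := cl (@cinf_val R H A @^-1` B) (@cinf_val R H A @^-1` C).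
- exact: cinf_val_continuous.
- exact: cinf_val_continuous.
by move=> z [Bz Cz]; exists (cinf_val z).
Qed.

Lemma cinf_AD x y : A (cinf_val (x + y)) = A x + A y.
Proof. exact: (cinf_iterD 1). Qed.

Lemma cinf_AZ (a : R) x : A (cinf_val (a *: x)) = a%:C%C *: A x.
Proof. exact: (cinf_iterZ 1). Qed.

Lemma omegaA_linl y : linear_for *%R ((omegaA A)^~ y).
Proof.
move=> a u v; rewrite /omegaA cinf_AD cinf_AZ linearDl/= linearZl_LR/=.
by rewrite raddfD/=; case: (hdot (A u) _) => p q /=; ring.
Qed.

Lemma omegaA_linr x : linear_for *%R (omegaA A x).
Proof.
move=> a u v; rewrite /omegaA.
have -> : cinf_val (a *: u + v) = a%:C%C *: cinf_val u + cinf_val v by [].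
rewrite linearDr/= linearZr_LR/=.
by rewrite raddfD/=; case: (hdot _ (cinf_val u)) => p q /=; ring.
Qed.

(** [0 <= hdot (A x) x] in [R[i]] forces this number to be real. *)
Lemma omegaA_alt x : omegaA A x x = 0.
Proof.
have := A_ge0 (cinf_dom x 0); rewrite lecE => /andP[/eqP].
by rewrite /omegaA /= => ->.
Qed.

(** Polarization: it reduces the joint continuity of the form to continuity of the norm. *)
Lemma omegaA_polar x y : omegaA A x y =
  2^-1 * (hnorm (A x + 'i%C *: cinf_val y) ^+ 2 - hnorm (A x) ^+ 2
          - hnorm (cinf_val y) ^+ 2).
Proof. by rewrite hnormD_sq Re_hdotZi hnormZi /omegaA; field. Qed.

Lemma omegaA_continuous :
  continuous (fun p : Cinf A * Cinf A => omegaA A p.1 p.2).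
Proof.
move=> p; rewrite /continuous_at.
under eq_fun do rewrite omegaA_polar.
rewrite omegaA_polar.
have cA : A (cinf_val q.1) @[q --> p] --> A (cinf_val p.1).
  by apply: (cvg_comp fst (fun z : Cinf A => iter 1 A z));
    [exact: cvg_fst|exact: (@cinf_iter_continuous R H A 1)].
have cv : cinf_val q.2 @[q --> p] --> cinf_val p.2.
  by apply: (cvg_comp snd (@cinf_val R H A));
    [exact: cvg_snd|exact: cinf_val_continuous].
have sq (f : Cinf A * Cinf A -> H) (l : H) : f q @[q --> p] --> l ->
    hnorm (f q) ^+ 2 @[q --> p] --> hnorm l ^+ 2.
  move=> fl; rewrite expr2; under eq_fun do rewrite expr2.
  by apply: cvgM; apply: (continuous_cvg _ _ fl); exact: hnorm_continuous.
apply: cvgMr; apply: cvgB; [apply: cvgB|]; apply: sq => //.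
by apply: cvgD => //; exact: cvgZr.
Qed.

Lemma omegaA_D x : omegaA A x (cinf_D x) = - hnorm (cinf_D x) ^+ 2.
Proof.
rewrite /omegaA hnormZi hnorm_sq -Re_hdotZi cinf_D_val scalerA -expr2 sqr_i.
by rewrite scaleN1r linearNr raddfN.
Qed.

(** The cross term is -2s Re<z, iAx> = -2s Im<z, Ax> = 2s Im<Ax, z>. *)
Lemma hnorm_subD (s : R) x z :
  hnorm (cinf_val (z - s *: cinf_D x)) ^+ 2 =
  hnorm z ^+ 2 + 2 * s * omegaA A x z + s ^+ 2 * hnorm (cinf_D x) ^+ 2.
Proof.
have -> : cinf_val (z - s *: cinf_D x) =
    cinf_val z + (- s)%:C%C *: ('i%C *: A x).
  by rewrite rmorphN scaleNr.
rewrite hnormD_sq hnormZr Re_hdotZr Re_hdotZi Im_hdotC /omegaA.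
by rewrite exprMn normrN real_normK ?num_real//; ring.
Qed.

Lemma hnorm_gammaA t x : hnorm (cinf_val (gammaA U t x)) = hnorm x.
Proof. by rewrite /hnorm /= expi_norm. Qed.

Lemma gammaA_lin t : linear (gammaA U t).
Proof. by move=> a x y; apply: val_inj; rewrite /= linearD linearZ. Qed.

Lemma gammaA0 x : gammaA U 0 x = x.
Proof. by apply: val_inj; rewrite /= expi0. Qed.

Lemma gammaAD s t x : gammaA U (s + t) x = gammaA U s (gammaA U t x).
Proof. by apply: val_inj; rewrite /= expiD. Qed.

Lemma iter_gammaA k t x : iter k A (gammaA U t x) = U t (iter k A x).
Proof. by elim: k => //= k ->; apply: (expi_dom _ _ _).2; exact: cinf_dom. Qed.

(** Convergence is tested on each A^k. Since A^k commutes with the unitary group, the quotient at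
    [x] becomes the one at A^k x, which the generator property handles. *)
Lemma gammaA_der x : has_dirder ((gammaA U)^~ x : R^o -> Cinf A) 0 1 (cinf_D x).
Proof.
apply/cvg_cinfP => k.
pose q (h : R) : Cinf A :=
  h^-1 *: (gammaA U (0 + h *: (1 : R^o)) x - gammaA U 0 x).
change (iter k A (q h) @[h --> (0 : R)^'] --> iter k A (cinf_val (cinf_D x))).
have -> : iter k A (cinf_val (cinf_D x)) = 'i%C *: A (iter k A x).
  have := iter_linop 'i%C k (cinf_A_in x) (cinf0 A).
  by rewrite iter_linop0 !addr0 -iterSr => ->.
have qE h : iter k A (q h) = h%:C%C^-1 *: (U h (iter k A x) - iter k A x).
  rewrite /q; have -> : (0 : R^o) + h *: (1 : R^o) = h.
    by rewrite add0r /GRing.scale/= mulr1.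
  rewrite cinf_iterZ cinf_iterD gammaA0 iter_gammaA fmorphV.
  by have := cinf_iterZ k (-1) x; rewrite scaleN1r => ->;
    rewrite rmorphN1 scaleN1r.
under eq_fun do rewrite qE.
exact/(expi_generator U)/(conj (cinf_dom x k)).
Qed.

Lemma osc_D_cinf x : osc_D (gammaA U) x = cinf_D x.
Proof. exact: (osc_DE cinf_hausdorff gammaA_der). Qed.

Lemma osc_Ad_cinf t x s t' x' s' :
  osc_Ad (omegaA A) (gammaA U) (t, x, s) (t', x', s') =
  (t' + omegaA A x (gammaA U s x') - 2^-1 * s' * omegaA A x (cinf_D x),
   gammaA U s x' - s' *: cinf_D x, s') :> osc R (Cinf A).
Proof.
exact: (osc_AdE cinf_hausdorff omegaA_linl omegaA_linr omegaA_alt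
  omegaA_continuous gammaA_lin gammaA0 gammaAD gammaA_der).
Qed.

Lemma osc_AdN_cinf g : {morph osc_Ad (omegaA A) (gammaA U) g : y / - y}.
Proof.
exact: (osc_AdN cinf_hausdorff omegaA_linl omegaA_linr omegaA_alt
  omegaA_continuous gammaA_lin gammaA0 gammaAD gammaA_der).
Qed.

(** Multiplying by [2 * s] gives a polynomial condition, from which openness and invariance are read
    off. *)
Lemma W_finE d t x s : W_fin A d (t, x, s) <->
  0 < s /\ 0 < 2 * s * t - hnorm x ^+ 2 + 2 * d * s ^+ 2.
Proof.
rewrite /W_fin /W_infty /=; split=> -[s0 h]; split=> //.
  have -> : 2 * s * t - hnorm x ^+ 2 + 2 * d * s ^+ 2 =
      2 * s * (t - (2 * s)^-1 * hnorm x ^+ 2 + d * s).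
    by field; rewrite gt_eqF.
  by rewrite mulr_gt0// mulr_gt0.
have -> : t - (2 * s)^-1 * hnorm x ^+ 2 + d * s =
    (2 * s)^-1 * (2 * s * t - hnorm x ^+ 2 + 2 * d * s ^+ 2).
  by field; rewrite gt_eqF.
by rewrite mulr_gt0// invr_gt0 mulr_gt0.
Qed.

Lemma W_infty_convex_cone : convex_cone (W_infty A).
Proof.
apply/convex_coneP; split=> [[[t x] s] [[t' x'] s']|r [[t x] s]] /=.
  exact: addr_gt0.
exact: mulr_gt0.
Qed.

Lemma W_fin_convex_cone d : convex_cone (W_fin A d).
Proof.
apply/convex_coneP; split=> [[[t x] s] [[t' x'] s']|r [[t x] s] r0] /=.
  move=> [s0 +] [s'0 +]; rewrite /W_infty /= in s0 s'0 *.
  move=> h h'; split; first exact: addr_gt0.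
  apply: lt_le_trans (addr_gt0 h h') _.
  have c2 : hnorm (cinf_val x + cinf_val x') ^+ 2 <= (hnorm x + hnorm x') ^+ 2.
    by rewrite ler_sqr ?nnegrE ?addr_ge0 ?hnorm_ge0// hnormD_le.
  have c3 : (2 * (s + s'))^-1 * hnorm (cinf_val x + cinf_val x') ^+ 2 <=
      (2 * s)^-1 * hnorm x ^+ 2 + (2 * s')^-1 * hnorm x' ^+ 2.
    (* The defect in the convexity of (a, s) |-> a^2 / s is an explicit square. *)
    have -> : (2 * s)^-1 * hnorm x ^+ 2 + (2 * s')^-1 * hnorm x' ^+ 2 =
       (2 * (s + s'))^-1 * ((hnorm x + hnorm x') ^+ 2 +
         (hnorm x * s' - hnorm x' * s) ^+ 2 / (s * s')).
      by field; rewrite !gt_eqF// addr_gt0.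
    apply: ler_wpM2l; first by rewrite invr_ge0 ltW// mulr_gt0// addr_gt0.
    apply: le_trans c2 _; rewrite lerDl.
    by apply: divr_ge0; [exact: sqr_ge0|rewrite ltW// mulr_gt0].
  change (t - (2 * s)^-1 * hnorm x ^+ 2 + d * s +
    (t' - (2 * s')^-1 * hnorm x' ^+ 2 + d * s') <= t + t' - (2 * (s + s'))^-1 *
    hnorm (cinf_val x + cinf_val x') ^+ 2 + d * (s + s') :> R).
  lra.
move=> [s0 h]; rewrite /W_infty /= in s0 *.
split; first exact: mulr_gt0.
change (0 < r * t - (2 * (r * s))^-1 * hnorm (r%:C%C *: cinf_val x) ^+ 2
  + d * (r * s) :> R).
rewrite hnormZr exprMn real_normK ?num_real//.
have -> : r * t - (2 * (r * s))^-1 * (r ^+ 2 * hnorm x ^+ 2) + d * (r * s) =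
    r * (t - (2 * s)^-1 * hnorm x ^+ 2 + d * s).
  by field; rewrite !gt_eqF.
exact: mulr_gt0.
Qed.

Lemma W_infty_open : open (W_infty A).
Proof.
apply: (@open_comp (osc R (Cinf A)) R snd [set r | 0 < r]).
  by move=> p _; exact: cvg_snd.
exact: open_gt.
Qed.

Lemma W_fin_open d : open (W_fin A d).
Proof.
have -> : W_fin A d = W_infty A `&`
   [set p : osc R (Cinf A) |
     0 < 2 * p.2 * p.1.1 - hnorm p.1.2 ^+ 2 + 2 * d * p.2 ^+ 2].
  by apply/seteqP; split=> -[[t x] s] /W_finE.
apply: openI; first exact: W_infty_open.
apply: (@open_comp (osc R (Cinf A)) R (fun p : osc R (Cinf A) =>
  2 * p.2 * p.1.1 - hnorm p.1.2 ^+ 2 + 2 * d * p.2 ^+ 2) [set r | 0 < r]);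
  last exact: open_gt.
move=> p _.
have c1 : q.1 @[q --> p] --> p.1 by exact: cvg_fst.
have c2 : q.2 @[q --> p] --> p.2 by exact: cvg_snd.
have c11 : q.1.1 @[q --> p] --> p.1.1.
  by apply: (cvg_comp _ fst c1); exact: cvg_fst.
have c12 : q.1.2 @[q --> p] --> p.1.2.
  by apply: (cvg_comp _ snd c1); exact: cvg_snd.
have cn : hnorm (cinf_val q.1.2) @[q --> p] --> hnorm p.1.2.
  apply: (continuous_cvg _ (@hnorm_continuous R H _)).
  by apply: (continuous_cvg _ (@cinf_val_continuous _)).
rewrite /continuous_at; apply: cvgD; first apply: cvgB.
- by apply: cvgM => //; exact: cvgMr.
- by rewrite expr2; under eq_fun do rewrite expr2; exact: cvgM.
- by apply: cvgMr; rewrite expr2; under eq_fun do rewrite expr2; exact: cvgM.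
Qed.

Lemma W_invariant d : osc_invariant (omegaA A) (gammaA U) (W A d).
Proof.
move=> [[t x] s] [[t' x'] s']; rewrite osc_Ad_cinf.
case: d => [d|//] /W_finE[s0 h]; apply/W_finE; split=> //.
rewrite hnorm_subD omegaA_D hnorm_gammaA.
(* The changes of [2 * s' * t'] and of the squared norm are equal and cancel. *)
by move: h; congr (0 < _); field.
Qed.

Lemma W_open_invariant_cone d :
  open_invariant_cone (omegaA A) (gammaA U) (W A d).
Proof.
split; last exact: W_invariant.
  by case: d => [d|]; [exact: W_fin_convex_cone|exact: W_infty_convex_cone].
by case: d => [d|]; [exact: W_fin_open|exact: W_infty_open].
Qed.

End smooth_vectors.

(** * The adjoint action of a general oscillator group, and reflected cones *)

Section oscillator_algebra.
Variables (R : realType) (V : tvsType R).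
Variables (omega : V -> V -> R) (gamma : R -> V -> V).

Lemma osc_has_dirder : oscillator omega gamma ->
  forall x, has_dirder (gamma^~ x : R^o -> V) 0 1 (osc_D gamma x).
Proof.
move=> oscG x; rewrite /osc_D.
suff [l hl] : exists l, has_dirder (gamma^~ x : R^o -> V) 0 1 l.
  by rewrite (dirderE (osc_hausdorff oscG) hl).
have [_ [df [hdf _]]] := osc_gamma_smooth oscG 1.
(* Orbit maps inherit their derivative from the jointly smooth action, in the direction of time. *)
exists (df ((0, x), (1, 0))).
have := hdf (0, x) (1, 0); rewrite /has_dirder /=.
by under eq_fun do rewrite scaler0 addr0.
Qed.

Lemma oscillator_AdE : oscillator omega gamma -> forall t x s t' x' s',
  osc_Ad omega gamma (t, x, s) (t', x', s') =
  (t' + omega x (gamma s x') - 2^-1 * s' * omega x (osc_D gamma x),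
   gamma s x' - s' *: osc_D gamma x, s') :> osc R V.
Proof.
move=> oscG; have [wl wr walt _ wc] := osc_symplectic oscG.
exact: (osc_AdE (osc_hausdorff oscG) wl wr walt wc (osc_gamma_linear oscG)
  (osc_gamma0 oscG) (osc_gammaD oscG) (osc_has_dirder oscG)).
Qed.

Lemma oscillator_AdN : oscillator omega gamma ->
  forall g, {morph osc_Ad omega gamma g : y / - y}.
Proof.
move=> oscG; have [wl wr walt _ wc] := osc_symplectic oscG.
exact: (osc_AdN (osc_hausdorff oscG) wl wr walt wc (osc_gamma_linear oscG)
  (osc_gamma0 oscG) (osc_gammaD oscG) (osc_has_dirder oscG)).
Qed.

Lemma preimage_oppE (E : zmodType) (C : set E) : -%R @` C = -%R @^-1` C.
Proof.
apply/seteqP; split=> [_ [x Cx <-]|x Cx] /=; first by rewrite opprK.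
by exists (- x) => //; rewrite opprK.
Qed.

Lemma open_invariant_coneN (C : set (osc R V)) :
  (forall g, {morph osc_Ad omega gamma g : y / - y}) ->
  open_invariant_cone omega gamma C ->
  open_invariant_cone omega gamma (-%R @^-1` C).
Proof.
move=> AdN [cC oC iC]; split; first exact: convex_coneN.
  by apply: open_comp oC => p _; exact: opp_continuous.
by move=> g y /= Cy; rewrite -AdN; exact: iC.
Qed.

End oscillator_algebra.

(** * Embedded oscillator groups *)

Section embedded.
Variables (R : realType) (H : hilbertType R) (A : linop H).
Hypothesis A_ge0 : nonnegative A.
Variables (U : expi A) (V : tvsType R).
Variables (omega : V -> V -> R) (gamma : R -> V -> V).
Hypothesis oscG : oscillator omega gamma.
Variable j : {linear V -> Cinf A}.
Hypothesis emb : osc_embedding omega gamma (omegaA A) (gammaA U) j.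
Hypothesis D_dense : dense (range (osc_D gamma)).

Local Notation D := (osc_D gamma).

(** Read off the middle coordinate of the product of [(0, 0, s)] and [(0, x, 0)]; the form and [D]
    come in the same way from one product and one bracket. *)
Lemma embedding_gamma s x : j (gamma s x) = gammaA U s (j x).
Proof.
have [_ /(_ (0, 0, s) (0, x, 0))] := embedding_group emb.
by rewrite /osc_mul /= => -[_]; rewrite linear0 !add0r.
Qed.

Lemma embedding_omega x y : omega x y = omegaA A (j x) (j y).
Proof.
have [_ /(_ (0, x, 0) (0, y, 0))] := embedding_group emb.
rewrite /osc_mul /= => -[+ _].
rewrite (osc_gamma0 oscG) gammaA0 !addr0 !add0r => /mulfI; apply.
by rewrite invr_eq0 pnatr_eq0.
Qed.

Lemma embedding_D x : j (D x) = cinf_D (j x).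
Proof.
have [_ _ /(_ (0, 0, 1) (0, x, 0))] := embedding_lie emb.
by rewrite /osc_bracket /= => -[_]; rewrite !scale0r !subr0 !scale1r osc_D_cinf.
Qed.

Lemma D_scale a x : D (a *: x) = a *: D x.
Proof.
apply: (embedding_inj emb); rewrite embedding_D !linearZ /= embedding_D.
apply: val_inj.
change ('i%C *: A (cinf_val (a *: j x)) = a%:C%C *: ('i%C *: A (j x))).
by rewrite cinf_AZ !scalerA mulrC.
Qed.

Lemma omega_D x : omega x (D x) = - hnorm (j (D x)) ^+ 2.
Proof. by rewrite embedding_omega embedding_D omegaA_D. Qed.

Lemma osc_Ad_map g y :
  osc_map j (osc_Ad omega gamma g y) =
  osc_Ad (omegaA A) (gammaA U) (osc_map j g) (osc_map j y).
Proof.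
move: g y => [[t x] s] [[t' x'] s'].
rewrite (oscillator_AdE oscG) /= (osc_Ad_cinf A_ge0).
have -> : j (gamma s x' - s' *: D x) = gammaA U s (j x') - s' *: cinf_D (j x).
  by rewrite linearB linearZ/= embedding_gamma embedding_D.
by rewrite !embedding_omega embedding_gamma embedding_D.
Qed.

Lemma osc_mapN y : osc_map j (- y) = - osc_map j y.
Proof. by move: y => [[t x] s]; rewrite /= raddfN. Qed.

Lemma open_invariant_cone_preimage (CA : set (osc R (Cinf A))) :
  open_invariant_cone (omegaA A) (gammaA U) CA ->
  open_invariant_cone omega gamma (osc_map j @^-1` CA).
Proof.
have [jl jc _] := embedding_lie emb.
move=> [/convex_coneP[aC sC] oC iC]; split.
- apply/convex_coneP; split=> [x y Cx Cy|r x r0 Cx].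
    change (CA (osc_map j (x + y))).
    by have := jl 1 x y; rewrite !scale1r => ->; exact: aC.
  change (CA (osc_map j (r *: x))).
  have j0 : osc_map j 0 = 0 by rewrite /= linear0.
  by have := jl r x 0; rewrite addr0 j0 addr0 => ->; exact: sC.
- by apply: open_comp oC => p _; exact: jc.
- by move=> g y Cy; rewrite /preimage /mkset osc_Ad_map; exact: iC.
Qed.

Lemma osc_D_neq0 : exists y, D y != 0.
Proof.
have [x x0] := osc_neq0 oscG.
have [] := D_dense (O := ~` [set 0]).
- by exists x; exact/eqP.
- apply: closed_openC; apply: accessible_closed_set1.
  exact: hausdorff_accessible (osc_hausdorff oscG).
by move=> z [z0 [y _ yE]]; exists y; rewrite yE; exact/eqP.
Qed.

Lemma hnorm_embedding_gt0 x : x != 0 -> 0 < hnorm (j x).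
Proof.
move=> /eqP x0; rewrite lt_def hnorm_ge0 andbT; apply/eqP => /hnorm_eq0 jx.
apply: x0; apply: (embedding_inj emb); rewrite linear0; exact: val_inj.
Qed.

(** These are the points that conjugation can slide onto the axis: that needs a vector in D(V) and a
    nonzero last coordinate. *)
Lemma range_D_points_dense :
  dense [set p : osc R V | p.2 != 0 /\ range D p.1.2].
Proof.
move=> O [[[t x] s] Op] oO.
have [e e0 he] := open_line ((0, 0, 1) : osc R V) oO Op.
(* At most one of the shifts [e / 2] and [e / 4] makes the last coordinate vanish. *)
have [h0 h0P] : exists h : R, `|h| < e /\ s + h != 0.
  have [s0|s0] := eqVneq (s + e / 2) 0.
    exists (e / 4); split; first by rewrite gtr0_norm; lra.
    by apply/eqP => ?; lra.
  by exists (e / 2); split; [rewrite gtr0_norm; lra|].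
case: h0P => /he Oh sh0.
pose f (x : V) : osc R V := (t, x, s + h0).
have fc : continuous f.
  by move=> z; apply: cvg_osc; [exact: cvg_cst|exact: cvg_id|exact: cvg_cst].
have [||z [Oz [y _ yE]]] := D_dense (O := f @^-1` O).
- exists x; move: Oh; rewrite /= /f.
  have -> : (t, x, s) + h0 *: ((0, 0, 1) : osc R V) =
     (t + h0 * 0, x + h0 *: 0, s + h0 * 1) by [].
  by rewrite mulr0 scaler0 mulr1 !addr0.
- by apply: open_comp oO => z _; exact: fc.
by exists (f z); split=> //; split=> //=; exists y.
Qed.

Variable C : set (osc R V).
Hypothesis C_cone : open_invariant_cone omega gamma C.

Let addC x y : C x -> C y -> C (x + y).
Proof. by have [/convex_coneP[h _] _ _] := C_cone; exact: h. Qed.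

Let scaleC (r : R) x : 0 < r -> C x -> C (r *: x).
Proof. by have [/convex_coneP[_ h] _ _] := C_cone; exact: h. Qed.

Let openC : open C. Proof. by have [] := C_cone. Qed.

Let AdC y (t : R) x (s : R) : C (t, x, s) ->
  C (t + omega y x - 2^-1 * s * omega y (D y), x - s *: D y, s).
Proof.
move=> Cx; have [_ _ iC] := C_cone.
have := iC (0, y, 0) _ Cx.
by rewrite (oscillator_AdE oscG) (osc_gamma0 oscG).
Qed.

Let scaleC_coord (r t s : R) (x : V) :
  0 < r -> C (t, x, s) -> C (r * t, r *: x, r * s).
Proof. by move=> r0 /(scaleC r0). Qed.

(* Conjugation by [exp y] removes the component along [D y]; the first
   coordinate is recovered from the invariance of [2 t s - |x|^2]. *)
Lemma cone_slide (t s : R) y : C (t, s *: D y, s) <->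
  C (t - 2^-1 * s * hnorm (j (D y)) ^+ 2, 0, s).
Proof.
have wl := symplectic_linearl (osc_symplectic oscG).
have wr := symplectic_linearr (osc_symplectic oscG).
(* Conjugation by [y] slides to the axis, conjugation by [- y] slides back. *)
split=> [/(AdC y)|/(AdC (- y))].
  rewrite (linear_for_mulZ _ _ (wr y)) omega_D subrr.
  have -> // : t + s * - hnorm (j (D y)) ^+ 2 -
    2^-1 * s * - hnorm (j (D y)) ^+ 2 = t - 2^-1 * s * hnorm (j (D y)) ^+ 2.
  by field.
have -> : D (- y) = - D y by rewrite -scaleN1r D_scale scaleN1r.
have := linear_for_mulZ 0 (0 : V) (wr (- y)); rewrite scale0r mul0r => ->.
have := linear_for_mulZ (-1) (D y) (wr (- y)); rewrite scaleN1r => ->.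
have := linear_for_mulZ (-1) y (wl (D y)); rewrite scaleN1r => ->.
rewrite omega_D scalerN opprK add0r.
have -> // : t - 2^-1 * s * hnorm (j (D y)) ^+ 2 + 0 -
  2^-1 * s * (-1 * (-1 * - hnorm (j (D y)) ^+ 2)) = t.
by field.
Qed.

Lemma hnorm_embeddingZ (a : R) x :
  hnorm (j (a *: x)) ^+ 2 = a ^+ 2 * hnorm (j x) ^+ 2.
Proof.
rewrite linearZ.
change (hnorm (a%:C%C *: cinf_val (j x)) ^+ 2 = a ^+ 2 * hnorm (j x) ^+ 2).
by rewrite hnormZr exprMn real_normK ?num_real.
Qed.

Lemma cone_slide_scaled (t s : R) y : s != 0 -> C (t, D y, s) <->
  C (t - (2 * s)^-1 * hnorm (j (D y)) ^+ 2, 0, s).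
Proof.
move=> s0; have := cone_slide t s (s^-1 *: y).
rewrite D_scale scalerA mulfV// scale1r hnorm_embeddingZ.
have -> // : 2^-1 * s * (s^-1 ^+ 2 * hnorm (j (D y)) ^+ 2) =
  (2 * s)^-1 * hnorm (j (D y)) ^+ 2.
by field.
Qed.

Lemma cone_scale_axis (t s : R) : 0 < s -> C (t, 0, s) <-> C (t / s, 0, 1).
Proof.
move=> s0; split=> [/(scaleC_coord (r := s^-1))|/(scaleC_coord s0)].
  by rewrite invr_gt0 scaler0 mulVf ?gt_eqF// mulrC; apply.
by rewrite scaler0 mulr1 mulrCA mulfV ?gt_eqF// mulr1.
Qed.

(** The slice of the open set [C] at fixed [t] and [s] is open, so it meets the dense set D(V). *)
Lemma cone_range_D (t s : R) x : C (t, x, s) -> exists y, C (t, D y, s).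
Proof.
move=> Cx; pose f (x : V) : osc R V := (t, x, s).
have fc : continuous f.
  by move=> z; apply: cvg_osc; [exact: cvg_cst|exact: cvg_id|exact: cvg_cst].
have [||z [Cz [y _ yE]]] := D_dense (O := f @^-1` C).
- by exists x.
- by apply: open_comp openC => z _; exact: fc.
by exists y; rewrite yE.
Qed.

Lemma cone_with_flat_point_full (t : R) x : C (t, x, 0) -> C = setT.
Proof.
move=> Cx.
have wl := symplectic_linearl (osc_symplectic oscG).
have wr := symplectic_linearr (osc_symplectic oscG).
(* If [x = 0], openness allows a small move along some [y] with [D y != 0], which is itself
   nonzero. *)
have [x1 x10 Cx1] : exists2 x1, x1 != 0 & C (t, x1, 0).
  have [x0|x0] := eqVneq x 0; last by exists x.
  have [y y0] := osc_D_neq0.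
  have [e e0 he] := open_line ((0, y, 0) : osc R V) openC Cx.
  have e20 : e / 2 != 0 by rewrite gt_eqF// divr_gt0.
  exists ((e / 2) *: y).
    by rewrite scaler_eq0 negb_or e20/=; apply: contraNneq y0 => ->;
      have := D_scale 0 0; rewrite !scale0r => ->.
  have := he (e / 2); rewrite gtr0_norm ?divr_gt0// => /(_ _)/wrap[|].
    lra.
  have -> : (t, x, 0) + (e / 2) *: ((0, y, 0) : osc R V) =
     (t + e / 2 * 0, x + (e / 2) *: y, 0 + e / 2 * 0) by [].
  by rewrite !mulr0 !addr0 x0 add0r.
(* At last coordinate 0, conjugation by [y] only adds [omega y x1] to the centre; a multiple of a
   [y] with [omega y x1 != 0] reaches every [b]. *)
have line b : C (b, x1, 0).
  have [y wy] : exists y, omega y x1 != 0.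
    apply: contrapT => h; move/eqP: x10; apply.
    apply: (symplectic_nondeg (osc_symplectic oscG)) => y.
    rewrite (alternating_skew _ _ wl wr (symplectic_alt (osc_symplectic oscG))).
    apply/eqP; rewrite oppr_eq0; apply: contrapT => /negP wy.
    by apply: h; exists y.
  have := AdC (((b - t) / omega y x1) *: y) Cx1.
  rewrite scale0r subr0 mulr0 mul0r subr0 (linear_for_mulZ _ _ (wl x1)).
  by rewrite divfK// addrC subrK.
(* Step back from [p] by a small multiple of [x1], then add that multiple of a point of the line:
   the vector parts cancel and [a] remains. *)
have translate (a : R) p : C p -> C (p + ((a, 0, 0) : osc R V)).
  move=> Cp; have [e e0 he] := open_line ((0, x1, 0) : osc R V) openC Cp.
  have e20 : 0 < e / 2 by rewrite divr_gt0.
  have h1 : C (p + - (e / 2) *: ((0, x1, 0) : osc R V)).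
    by apply: he; rewrite normrN gtr0_norm; lra.
  have := addC h1 (scaleC e20 (line (a / (e / 2)))).
  rewrite -addrA scaleNr.
  have -> // : - ((e / 2) *: ((0, x1, 0) : osc R V)) +
     (e / 2) *: (a / (e / 2), x1, 0) = (a, 0, 0).
  have -> : - ((e / 2) *: ((0, x1, 0) : osc R V)) +
     (e / 2) *: (a / (e / 2), x1, 0) = (- (e / 2 * 0) + e / 2 * (a / (e / 2)),
       - ((e / 2) *: x1) + (e / 2) *: x1, - (e / 2 * 0) + e / 2 * 0) by [].
  by rewrite addNr !mulr0 addr0 oppr0 add0r mulrCA mulfV ?gt_eqF// mulr1.
have [e e0 he] := open_line ((0, 0, 1) : osc R V) openC Cx.
(* Move from the flat point to height [r * s], of absolute value [e / 2]; slide to the axis, correct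
   the central coordinate by [translate], and divide by [r]. *)
have axis (s b : R) : s != 0 -> C (b, 0, s).
  move=> s0; pose r := e / 2 / `|s|.
  have r0 : 0 < r by rewrite !divr_gt0// normr_gt0.
  have rs0 : r * s != 0 by rewrite mulf_neq0// gt_eqF.
  have := he (r * s).
  rewrite normrM gtr0_norm// divfK ?normr_eq0// => /(_ _)/wrap[|]; first lra.
  have -> : (t, x, 0) + (r * s) *: ((0, 0, 1) : osc R V) =
     (t + r * s * 0, x + (r * s) *: 0, 0 + r * s * 1) by [].
  rewrite mulr0 scaler0 !addr0 mulr1 add0r => /cone_range_D[y].
  move=> /(cone_slide_scaled _ _ rs0); set c := t - _.
  move=> /(translate (r * b - c)).
  have -> : (c, 0, r * s) + ((r * b - c, 0, 0) : osc R V) =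
     (c + (r * b - c), 0 + 0, r * s + 0) by [].
  rewrite !addr0 addrC subrK => /(scaleC_coord (r := r^-1)).
  by rewrite invr_gt0 scaler0 !mulKf ?gt_eqF//; apply.
apply/seteqP; split=> //.
have [convC _ _] := C_cone.
apply: (cone_sub_dense openT openC convC range_D_points_dense).
move=> [[b z] s] /= [s0 [y _ <-]] _.
exact/(cone_slide_scaled _ _ s0)/axis.
Qed.

Lemma cone_axis_up (t a : R) : C (t, 0, 1) -> 0 < a -> C (t + a, 0, 1).
Proof.
move=> Ct a0; have [y0 /hnorm_embedding_gt0 n0] := osc_D_neq0.
set n := hnorm _ in n0.
(* With this [c] the squared norm of D (c y0) is 2a, so [cone_slide] raises the central coordinate
   by exactly [a]. *)
have Cy (c : R) : c ^+ 2 = 2 * a / n ^+ 2 -> C (t + a, D (c *: y0), 1).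
  move=> cE; rewrite -[D _]scale1r; apply/cone_slide.
  rewrite D_scale hnorm_embeddingZ -/n cE.
  have -> // : t + a - 2^-1 * 1 * (2 * a / n ^+ 2 * n ^+ 2) = t.
  by field; rewrite gt_eqF.
pose r := Num.sqrt (2 * a / n ^+ 2).
have rE : r ^+ 2 = 2 * a / n ^+ 2.
  by rewrite sqr_sqrtr// ltW// divr_gt0 ?exprn_gt0// mulr_gt0.
(* Both square roots qualify, and the midpoint of the two resulting points is back on the axis. *)
have Cr := Cy r rE; have := Cy (- r); rewrite sqrrN => /(_ rE) CNr.
have h0 : 0 < 2^-1 :> R by rewrite invr_gt0.
have := scaleC h0 (addC Cr CNr).
have -> : 2^-1 *: (((t + a, D (r *: y0), 1) : osc R V) +
                   (t + a, D (- r *: y0), 1)) =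
   (2^-1 * (t + a + (t + a)), 2^-1 *: (D (r *: y0) + D (- r *: y0)),
    2^-1 * (1 + 1)) by [].
rewrite !D_scale -scalerDl subrr scale0r scaler0.
have -> : 2^-1 * (t + a + (t + a)) = t + a by field.
by have -> : 2^-1 * (1 + 1) = 1 :> R by field.
Qed.

Lemma positive_cone_classification : C !=set0 -> (forall p, C p -> 0 < p.2) ->
  exists d, C = osc_map j @^-1` W A d.
Proof.
move=> [[[t0 x0] s0] Cp0] Cpos.
pose I := [set t : R | C (t, 0, 1)].
have I0 : I !=set0.
  have sp := Cpos _ Cp0; rewrite /= in sp.
  have [y /(cone_slide_scaled _ _ (lt0r_neq0 sp))] := cone_range_D Cp0.
  by move=> /(cone_scale_axis _ sp) It; eexists; exact: It.
(* [Some r] stands for I = ]-r, oo[, since [(t, 0, 1)] lies in W_r exactly when t + r > 0; [None]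
   stands for I = R. *)
suff [d dP] : exists d : option R,
    forall t, I t <-> if d is Some r then - r < t else True.
  exists d.
  have [convC _ _] := C_cone.
  have [convW oW _] :=
    open_invariant_cone_preimage (W_open_invariant_cone A_ge0 U d).
  have agree p : p.2 != 0 /\ range D p.1.2 -> C p <-> (osc_map j @^-1` W A d) p.
    case: p => [[t x] s] /= [s1 [y _ <-]].
    (* Neither cone has points with [s <= 0]. *)
    have [sp|sp] := ltP 0 s; last first.
      split=> [/Cpos/=|]; first by rewrite ltNge sp.
      by case: d {dP convW oW} => [d|] /= => [[+ _]|];
        rewrite /W_infty /= ltNge sp.
    (* Sliding to the axis and rescaling to height 1 turns membership in [C] into membership in
       [I]. *)
    apply: (iff_trans (cone_slide_scaled _ _ s1)).
    apply: (iff_trans (cone_scale_axis _ sp)).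
    apply: (iff_trans (dP _)).
    case: d {dP convW oW} => [d|] //=.
    set n := _ * _ ^+ 2.
    by rewrite ltr_pdivlMr// mulNr -subr_gt0 opprK; split=> [h|[_ h]].
  apply/seteqP; split.
    apply: (cone_sub_dense openC oW convW range_D_points_dense).
    by move=> p /agree[].
  by apply: (cone_sub_dense oW openC convC range_D_points_dense) => p /agree[].
(* An up-set without lower bound is the whole line. *)
have [lbI|lbI] := pselect (has_lbound I); last first.
  exists None => t; split=> // _; apply: contrapT => nIt; apply: lbI.
  exists t => u Iu; rewrite leNgt; apply/negP => ut; apply: nIt.
  by rewrite -(subrK u t) addrC; apply: cone_axis_up => //; rewrite subr_gt0.
exists (Some (- inf I)) => t; rewrite opprK; split=> [It|].
  (* Openness along the centre shows that the infimum is not attained, so the inequality is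
     strict. *)
  have [e e0 he] := open_line ((1, 0, 0) : osc R V) openC It.
  have := he (- (e / 2)).
  rewrite normrN gtr0_norm ?divr_gt0// => /(_ _)/wrap[|].
    lra.
  have -> : (t, 0, 1) + - (e / 2) *: ((1, 0, 0) : osc R V) =
     (t + - (e / 2) * 1, 0 + - (e / 2) *: 0, 1 + - (e / 2) * 0) by [].
  rewrite scaler0 mulr0 !addr0 mulr1 => Ite.
  apply: le_lt_trans (ge_inf lbI Ite) _; lra.
move=> /(inf_lt I0)[u Iu ut].
by rewrite -(subrK u t) addrC; apply: cone_axis_up => //; rewrite subr_gt0.
Qed.

End embedded.

(** * Classification *)

Section classification.
Variables (R : realType) (H : hilbertType R) (A : linop H).
Hypothesis A_ge0 : nonnegative A.
Variables (U : expi A) (V : tvsType R).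
Variables (omega : V -> V -> R) (gamma : R -> V -> V).
Hypothesis oscG : oscillator omega gamma.
Variable j : {linear V -> Cinf A}.
Hypothesis emb : osc_embedding omega gamma (omegaA A) (gammaA U) j.
Hypothesis D_dense : dense (range (osc_D gamma)).

Lemma open_invariant_cone_classification (C : set (osc R V)) :
  C !=set0 -> C <> setT -> open_invariant_cone omega gamma C ->
  exists d : option R, C = osc_map j @^-1` (W A d) \/
                       C = osc_map j @^-1` (-%R @` W A d).
Proof.
move=> C0 CT C_cone.
have nflat p : C p -> p.2 != 0.
  case: p => [[t x] s] Cp /=; apply/eqP => s0; apply: CT; rewrite s0 in Cp.
  exact: (cone_with_flat_point_full oscG emb D_dense C_cone Cp).
have [Cpos|/existsNP[p /not_implyP[Cp /negP]]] :=
  pselect (forall p, C p -> 0 < p.2).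
  have [d ->] :=
    positive_cone_classification A_ge0 oscG emb D_dense C_cone C0 Cpos.
  by exists d; left.
rewrite -leNgt le_eqVlt (negbTE (nflat _ Cp))/= => pn.
have [/convex_coneP[aC sC] _ _] := C_cone.
have Cneg q : C q -> q.2 < 0.
  move=> Cq; rewrite ltNge le_eqVlt eq_sym (negbTE (nflat _ Cq))/=.
  apply/negP => q0.
  have pn' : 0 < - p.2 by rewrite oppr_gt0.
  (* If [p.2 < 0 < q.2], this positive combination of [p] and [q] has last coordinate 0, which is
     excluded. *)
  have := nflat _ (aC _ _ (sC _ _ q0 Cp) (sC _ _ pn' Cq)).
  have -> : (q.2 *: p + - p.2 *: q).2 = q.2 * p.2 + - p.2 * q.2 by [].
  by rewrite mulNr mulrC subrr eqxx.
have NC0 : (-%R @^-1` C) !=set0 by exists (- p); rewrite /preimage /= opprK.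
have Npos q : (-%R @^-1` C) q -> 0 < q.2 by move=> /Cneg; rewrite oppr_lt0.
have [d dE] := positive_cone_classification A_ge0 oscG emb D_dense
  (open_invariant_coneN (oscillator_AdN oscG) C_cone) NC0 Npos.
exists d; right; apply/seteqP; rewrite preimage_oppE; split=> y Cy.
  change (W A d (- osc_map j y)); rewrite -osc_mapN.
  by change ((osc_map j @^-1` W A d) (- y)); rewrite -dE /preimage /= opprK.
have : (osc_map j @^-1` W A d) (- y) by rewrite /preimage /mkset osc_mapN.
by rewrite -dE /preimage /= opprK.
Qed.

Lemma W_preimage_proper d :
  osc_map j @^-1` W A d !=set0 /\ osc_map j @^-1` W A d <> setT.
Proof.
split.
  (* At height 1 on the axis the condition is [0 < t + d]; the default 0 covers [None]. *)
  exists (1 + `|odflt 0 d|, 0, 1).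
  change (W A d (1 + `|odflt 0 d|, j 0, 1)); rewrite linear0.
  case: d => [d|] /=; rewrite /W_fin/= /W_infty/= ?ltr01//; split=> //.
  rewrite hnorm0 expr0n mulr0 subr0 mulr1 -addrA ltr_pwDl// -lerBlDr sub0r.
  by rewrite -normrN ler_norm.
move=> /seteqP[_ /(_ ((0, 0, -1) : osc R V) I)].
change (W A d (0, j 0, -1) -> False).
by case: d => [d|] /=; [case|]; rewrite /W_infty /= ltr0N1.
Qed.

End classification.

Theorem proposition2p9 (R : realType)
    (* the standard oscillator group G_A *)
    (H : hilbertType R) (H_neq0 : exists x : H, x != 0)
    (A : linop H) (A_sa : self_adjoint A) (A_ge0 : nonnegative A)
    (A_ker : trivial_kernel A) (eitA : expi A)
    (* the oscillator group G = G(V, omega, gamma) *)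
    (V : tvsType R) (omega : V -> V -> R) (gamma : R -> V -> V)
    (oscG : oscillator omega gamma)
    (* the embedding *)
    (j : {linear V -> Cinf A})
    (emb : osc_embedding omega gamma (omegaA A) (gammaA eitA) j)
    (D_dense : dense (range (osc_D gamma))) :
  (forall C : set (osc R V),
     [/\ C !=set0, C <> setT & open_invariant_cone omega gamma C] <->
     exists d : option R,
       C = osc_map j @^-1` (W A d) \/
       C = osc_map j @^-1` (-%R @` W A d)) /\
  (forall C : set (osc R V), open_invariant_cone omega gamma C ->
     exists CA : set (osc R (Cinf A)),
       open_invariant_cone (omegaA A) (gammaA eitA) CA /\
       C = osc_map j @^-1` CA).
Proof.
have WN d : open_invariant_cone (omegaA A) (gammaA eitA) (-%R @` W A d).
  rewrite preimage_oppE; apply: open_invariant_coneN; first exact: osc_AdN_cinf.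
  exact: W_open_invariant_cone.
have pre := open_invariant_cone_preimage A_ge0 oscG emb.
have classify := open_invariant_cone_classification A_ge0 oscG emb D_dense.
split=> [C|C C_cone].
  split=> [[C0 CT C_cone]|[d dE]]; first exact: classify.
  have [[p Wp] WT] := W_preimage_proper j d.
  case: dE => ->; split;
    [by exists p|by []|exact/pre/W_open_invariant_cone| | |exact: pre].
    by exists (- p); rewrite preimage_oppE /preimage /mkset osc_mapN opprK.
  rewrite preimage_oppE => NT; apply: WT; apply/seteqP; split=> // y _.
  have : setT (- y) by []; rewrite -NT /preimage /mkset osc_mapN opprK; exact.
(* The empty and the full cone escape the classification, but are preimages of the empty and the
   full cone. *)
have [->|/set0P C0] := eqVneq C set0.
  exists set0; split; last by rewrite preimage_set0.
  split; last by move=> g y.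
    by apply/convex_coneP; split.
  exact: open0.
have [->|/eqP CT] := eqVneq C setT.
  exists setT; split; last by rewrite preimage_setT.
  by split=> //; [apply/convex_coneP; split|exact: openT].
have [d [->|->]] := classify C C0 CT C_cone.
  by exists (W A d); split=> //; exact: W_open_invariant_cone.
by exists (-%R @` W A d).
Qed.
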